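(* For every odd prime $p>2$, \[ \sum_{k=0}^{\frac{p-1}{2}}\frac{11k+3}{64^{k}}\binom{2k}{k}^2\binom{3k}{k} \equiv 3p+3p^2q_p(2) \pmod{p^3}. \]
   Context: For an odd prime $p$, the Fermat quotient is $q_p(2)=\frac{2^{p-1}-1}{p}$. Congruences between rational numbers whose denominators are coprime to $p$ are understood in the ring of $p$-integral rationals. *)

(* Defs.v *)
From mathcomp Require Import all_boot all_order all_algebra.
Set Implicit Arguments. Unset Strict Implicit. Unset Printing Implicit Defensive.
Import Order.TTheory GRing.Theory Num.Theory.
Local Open Scope ring_scope.

Definition fermat_q2 (p : nat) : rat := ((2 ^ p.-1)%N%:R - 1) / p%:R.

Definition p_integral (p : nat) (x : rat) : bool := coprime `|denq x|%N p.

Definition congr_pk (p k : nat) (x y : rat) : Prop :=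
  p_integral p ((x - y) / (p ^ k)%N%:R).

(* Main.v *)
Require Import Defs.
From mathcomp Require Import all_boot all_order all_algebra.
From mathcomp Require Import ring lra zify.
Import Order.TTheory GRing.Theory Num.Theory.
Local Open Scope ring_scope.
Set Implicit Arguments.
Unset Strict Implicit.

(** Write [p = 2N + 1], [x = 2^(p-1) = 4^N]. A WZ pair, obtained from a well-poised
    (Dougall type) sum, turns the partial sum up to [m] into
    [48 / 64^(m+1) * \sum_(k <= m) dual_term m k].
    For [m = N] all the terms with [k > 0] are divisible by [p^2], and modulo [p^3]
    they are [-4 p^2 (-1)^k / (k (k+1))] for [k < N] and [8 p^2 (-1)^N] for [k = N].
    With [H = \sum_(j <= N) 1/j] and [A = \sum_(j <= N) (-1)^j/j], the term [k = 0] is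
    [4 p (1 + p) (1 - p H)] and the others add up to [-4 p^2 (2 A + 1)].
    Expanding [\sum_j C(p, 2j) y^j] modulo [p^2] at [y = 1] and [y = -1], where it
    equals [x] and a square root of [x], gives [p H = 2 (1 - x)] and [p A = 1 - x]
    modulo [p^2]; the sum is then [3 p (4 x - 3) / x^3 = 3 p x] modulo [p^3]. *)

(** * The WZ pair *)

Definition summand (n : nat) : rat :=
  (11 * n + 3)%N%:R / (64 ^ n)%N%:R * ('C(n.*2, n) ^ 2 * 'C(3 * n, n))%N%:R.

Definition cbin (n : nat) : rat := 'C(n.*2, n)%:R.

Lemma factrS (n : nat) : n.+1`!%:R = (n%:R + 1) * n`!%:R :> rat.
Proof. by rewrite factS natrM -natr1. Qed.

Lemma factr_neq0 (n : nat) : n`!%:R != 0 :> rat.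
Proof. by rewrite pnatr_eq0 -lt0n fact_gt0. Qed.

Lemma binr_addE (i j : nat) :
  'C(i + j, j)%:R = (i + j)`!%:R / (j`!%:R * i`!%:R) :> rat.
Proof.
have := @bin_fact (i + j) j; rewrite leq_addl addnK => /(_ isT) <-.
by rewrite !natrM; field; rewrite !factr_neq0.
Qed.

Lemma cbinE (n : nat) : cbin n = n.*2`!%:R / n`!%:R ^+ 2.
Proof. by rewrite /cbin -addnn binr_addE. Qed.

Lemma cbinS (n : nat) : cbin n.+1 = 2 * (2 * n%:R + 1) / (n%:R + 1) * cbin n.
Proof.
rewrite !cbinE doubleS !factrS -!natr1 -muln2 natrM.
have n0 := ler0n rat n; field; rewrite factr_neq0 /=; apply/eqP; lra.
Qed.

(** Meant for [k <= m] only: the subtractions truncate, so beyond that range the terms do not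
    vanish. *)
Definition dual_term (m k : nat) : rat :=
  (2 * k + 1)%N%:R * cbin (m.+1 + k) * cbin (m - k)
  * (3 * m + 2)`!%:R * (2 * m + 2)`!%:R
  / (m.+1`!%:R * (2 * m + 1 - k)`!%:R * (2 * m + 2 + k)`!%:R).

Definition dual_summand (m k : nat) : rat := 48 / (64 ^ m.+1)%N%:R * dual_term m k.

(* A rational multiple of [dual_summand m k], written with [cbin (m.+1 - k)] so that it
   still makes sense, and is nonzero, at [k = m.+1]. *)
Definition wz_cert (m k : nat) : rat :=
  let M := m%:R in let K := k%:R in
  12 / (64 ^ m.+1)%N%:R * cbin (m.+1 + k) * cbin (m.+1 - k)
  * (3 * m + 2)`!%:R * (2 * m + 2)`!%:R
  / (m.+1`!%:R * (2 * m + 3 - k)`!%:R * (2 * m + 3 + k)`!%:R)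
  * (K ^+ 4 - (8 * M ^+ 2 + 43 / 2 * M + 29 / 2) * K ^+ 2
     - (11 * M + 14) * (M + 1) * (M + 3 / 2) ^+ 2).

Lemma exp64S (m : nat) : (64 ^ m.+1)%N%:R = 64 * (64 ^ m)%N%:R :> rat.
Proof. by rewrite expnS natrM. Qed.
Lemma exp64_neq0 (m : nat) : (64 ^ m)%N%:R != 0 :> rat.
Proof. by rewrite pnatr_eq0 expn_eq0. Qed.

(** Taking [m = k + j] encodes [k <= m] and removes every truncated subtraction. Once all factorials
    and central binomials are brought to a common base, a rational function identity in [j] and [k]
    remains. *)
Lemma dual_summand_wz (j k : nat) (m := (k + j)%N) :
  dual_summand m.+1 k - dual_summand m k = wz_cert m k.+1 - wz_cert m k.
Proof.
rewrite /dual_summand /dual_term /wz_cert.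
have -> : (m.+2 + k = (k + k + j).+2)%N by rewrite /m; lia.
have -> : (m.+1 + k = (k + k + j).+1)%N by rewrite /m; lia.
have -> : (m.+1 + k.+1 = (k + k + j).+2)%N by rewrite /m; lia.
have -> : (m.+1 - k = j.+1)%N by rewrite /m; lia.
have -> : (m.+1 - k.+1 = j)%N by rewrite /m; lia.
have -> : (m - k = j)%N by rewrite /m; lia.
have -> : (3 * m.+1 + 2 = (3 * m + 2).+3)%N by lia.
have -> : (2 * m.+1 + 2 + k = (2 * m + 2 + k).+2)%N by lia.
have -> : (2 * m.+1 + 2 = (2 * m + 2).+2)%N by lia.
have -> : (2 * m.+1 + 1 - k = (k + j + j + 1).+2)%N by rewrite /m; lia.
have -> : (2 * m + 1 - k = k + j + j + 1)%N by rewrite /m; lia.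
have -> : (2 * m + 3 - k = (k + j + j + 1).+2)%N by rewrite /m; lia.
have -> : (2 * m + 3 - k.+1 = (k + j + j + 1).+1)%N by rewrite /m; lia.
have -> : (2 * m + 3 + k = (2 * m + 2 + k).+1)%N by lia.
have -> : (2 * m + 3 + k.+1 = (2 * m + 2 + k).+2)%N by lia.
rewrite !exp64S (cbinS j) (cbinS (k+k+j).+1) !factrS.
have := exp64_neq0 m; have := factr_neq0 m; have := factr_neq0 (k + j + j + 1).
have := factr_neq0 (2 * m + 2 + k).
move: (cbin _) (cbin j) => B b.
move: (64 ^ m)%N%:R (m`!%:R) ((k + j + j + 1)`!%:R) ((2 * m + 2 + k)`!%:R) => e f1 f2 f3.
move: ((3 * m + 2)`!%:R) ((2 * m + 2)`!%:R) => g1 g2 f3n f2n f1n en.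
have k0 := ler0n rat k; have j0 := ler0n rat j.
rewrite /m; field.
rewrite en f1n f2n f3n /=.
by repeat (apply/andP; split); apply/eqP; lra.
Qed.

(** The WZ equation at [k = m + 1], where the two missing terms would carry a central binomial of
    index [-1], that is [0]; truncated subtraction would make it [1], hence the separate
    statement. *)
Lemma dual_summand_wz_last (m : nat) : dual_summand m.+1 m.+1 = - wz_cert m m.+1.
Proof.
rewrite /dual_summand /dual_term /wz_cert !subnn.
have -> : (m.+2 + m.+1 = (m.+1 + m.+1).+1)%N by lia.
have -> : (3 * m.+1 + 2 = (3 * m + 2).+3)%N by lia.
have -> : (2 * m.+1 + 2 + m.+1 = (2 * m + 3 + m.+1).+1)%N by lia.
have -> : (2 * m.+1 + 2 = (2 * m + 2).+2)%N by lia.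
have -> : (2 * m.+1 + 1 - m.+1 = m.+2)%N by lia.
have -> : (2 * m + 3 - m.+1 = m.+2)%N by lia.
rewrite !exp64S (cbinS (m.+1 + m.+1)) !factrS.
have := exp64_neq0 m; have := factr_neq0 m; have := factr_neq0 (2 * m + 3 + m.+1).
move: (cbin (_ + _)) (cbin 0) => B b.
move: (64 ^ m)%N%:R (m`!%:R) ((2 * m + 3 + m.+1)`!%:R) => e f1 f2.
move: ((3 * m + 2)`!%:R) ((2 * m + 2)`!%:R) => g1 g2 f2n f1n en.
have m0 := ler0n rat m.
field.
rewrite en f1n f2n /=.
by repeat (apply/andP; split); apply/eqP; lra.
Qed.

(** At [K = 0] only the last product of the polynomial survives, and its factor [11 * M + 14] is
    [11 * (m + 1) + 3]. *)
Lemma wz_cert0 (m : nat) : wz_cert m 0 = - summand m.+1.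
Proof.
rewrite /summand /wz_cert [('C(_, _) ^ 2 * _)%:R]natrM [('C(_, _) ^ 2)%:R]natrX.
rewrite -/(cbin m.+1) !subn0 !addn0.
have -> : (3 * m.+1 = 2 * m + 2 + m.+1)%N by lia.
rewrite binr_addE.
have -> : (2 * m + 2 + m.+1 = (3 * m + 2).+1)%N by lia.
have -> : (2 * m + 3 = (2 * m + 2).+1)%N by lia.
rewrite !factrS !exp64S.
have m0 := ler0n rat m.
have := exp64_neq0 m; have := factr_neq0 m; have := factr_neq0 (2 * m + 2).
move: (64 ^ m)%N%:R (m`!%:R) ((2 * m + 2)`!%:R) => e f1 f2 f2n f1n en.
field.
rewrite en f1n f2n /=.
by repeat (apply/andP; split); apply/eqP; lra.
Qed.

(** Summed over [k <= m], the WZ equation telescopes. The new term [k = m + 1] cancels the upper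
    end, and the lower end is the new summand. *)
Lemma sum_summand_dual (m : nat) :
  \sum_(0 <= n < m.+1) summand n = \sum_(0 <= k < m.+1) dual_summand m k.
Proof.
elim: m => [|m IHm].
  rewrite !big_nat1 /summand /dual_summand /dual_term /cbin /=.
  by rewrite !binS !bin0 !bin0n /=; vm_compute.
rewrite big_nat_recr //= IHm [RHS]big_nat_recr //= dual_summand_wz_last.
have tel : \sum_(0 <= k < m.+1) (dual_summand m.+1 k - dual_summand m k)
         = wz_cert m m.+1 + summand m.+1.
  have := telescope_sumr (wz_cert m) (leq0n m.+1); rewrite wz_cert0 opprK => <-.
  apply: eq_big_nat => k /andP[_ km].
  by have := dual_summand_wz (m - k) k; rewrite /= subnKC.
rewrite sumrB in tel; rewrite -[X in X - _](subrK (\sum_(0 <= k < m.+1) dual_summand m k)) tel.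
by rewrite [in RHS]addrC addrA addKr addrC.
Qed.

Lemma dual_termS (j k : nat) (m := (k + j.+1)%N) (p := (2 * m + 1)%N%:R : rat) :
  let K := k%:R in
  dual_term m k.+1 = dual_term m k *
    ((2 * K + 3) * (p + 2 + 2 * K) * (p - 1 - 2 * K) * (p - K)
     / ((2 * K + 1) * (p + 3 + 2 * K) * (p - 2 - 2 * K) * (p + 2 + K))).
Proof.
rewrite /dual_term /p /=.
have -> : (m.+1 + k.+1 = (m.+1 + k).+1)%N by lia.
have -> : (m - k = j.+1)%N by rewrite /m; lia.
have -> : (m - k.+1 = j)%N by rewrite /m; lia.
have -> : (2 * m + 1 - k = (k + j + j + 2).+1)%N by rewrite /m; lia.
have -> : (2 * m + 1 - k.+1 = k + j + j + 2)%N by rewrite /m; lia.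
have -> : (2 * m + 2 + k.+1 = (2 * m + 2 + k).+1)%N by lia.
rewrite (cbinS j) (cbinS (m.+1 + k)) (factrS (k + _ + _ + _)) (factrS (2 * m + 2 + k)).
have := factr_neq0 m.+1; have := factr_neq0 (k + j + j + 2).
have := factr_neq0 (2 * m + 2 + k).
move: (cbin _) (cbin j) => B b.
move: (m.+1`!%:R) ((k + j + j + 2)`!%:R) ((2 * m + 2 + k)`!%:R) => f1 f2 f3.
move: ((3 * m + 2)`!%:R) ((2 * m + 2)`!%:R) => g1 g2 f3n f2n f1n.
have k0 := ler0n rat k; have j0 := ler0n rat j.
rewrite /m; field.
rewrite f1n f2n f3n /=.
by repeat (apply/andP; split); apply/eqP; lra.
Qed.

(** The binomials are ['C(p - 1, m)] and ['C(p + m, m)], the combination expanded in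
    [congr_bin_square_bin]. *)
Lemma dual_term0 (m : nat) (p := (2 * m + 1)%N%:R : rat) :
  dual_term m 0 = 4 * p * (3 * p + 1) / (p + 1) ^+ 2
    * ('C(2 * m, m)%:R ^+ 2 * 'C(3 * m + 1, m)%:R).
Proof.
rewrite /dual_term /p !addn0 !subn0 cbinS -/(cbin m).
have -> : 'C(2 * m, m) = 'C(m.*2, m) by rewrite mul2n.
rewrite -/(cbin m).
have -> : (3 * m + 1 = (2 * m + 1) + m)%N by lia.
rewrite binr_addE.
have -> : (2 * m + 2 = (2 * m + 1).+1)%N by lia.
have -> : (3 * m + 2 = (2 * m + 1 + m).+1)%N by lia.
rewrite !factrS.
have := factr_neq0 m; have := factr_neq0 (2 * m + 1).
move: (cbin m) (m`!%:R) ((2 * m + 1)`!%:R) ((2 * m + 1 + m)`!%:R) => b f1 f2 g f2n f1n.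
have m0 := ler0n rat m.
field.
rewrite f1n f2n /=.
by repeat (apply/andP; split); apply/eqP; lra.
Qed.

(** * Congruences in the ring of p-integral rationals *)

Section PIntegral.
Variable p : nat.
Hypothesis p_pr : prime p.

(** Any denominator prime to [p] will do, so closure under sums and products needs no reduction to
    lowest terms. Conversely, [denq x] is coprime to [numq x], hence divides such a [d]. *)
Lemma p_integralP (x : rat) :
  reflect (exists2 d : nat, coprime d p & x * d%:R \is a Num.int) (p_integral p x).
Proof.
apply: (iffP idP) => [cdp | [d cdp /intrP[z xdz]]].
  exists `|denq x|%N => //.
  by rewrite natr_absz ger0_norm // -[X in X * _]divq_num_den divfK ?intr_int // intr_eq0 denq_eq0.
rewrite /p_integral; apply: coprime_dvdl cdp.
have d0 : (denq x)%:~R != 0 :> rat by rewrite intr_eq0 denq_eq0.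
have e : numq x * d%:Z = z * denq x.
  apply: (@intr_inj rat); rewrite !intrM -xdz [RHS]mulrAC; congr (_ * _).
  by rewrite -[X in X * _]divq_num_den divfK.
have : (denq x %| numq x * d%:Z)%Z by rewrite e dvdz_mull.
rewrite Gauss_dvdzr; last by rewrite coprimez_sym /coprimez /gcdz eqz_nat; exact: coprime_num_den.
by rewrite dvdzE.
Qed.

Lemma p_integral_int (z : int) : p_integral p z%:~R.
Proof. by apply/p_integralP; exists 1%N; rewrite ?coprime1n // mulr1 intr_int. Qed.

Lemma p_integral_nat (n : nat) : p_integral p n%:R.
Proof. exact: (p_integral_int n). Qed.

Lemma p_integralD (x y : rat) : p_integral p x -> p_integral p y -> p_integral p (x + y).
Proof.
move=> /p_integralP[d cd xd] /p_integralP[e ce ye]; apply/p_integralP.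
exists (d * e)%N; first by rewrite coprimeMl cd.
have -> : (x + y) * (d * e)%N%:R = x * d%:R * e%:R + y * e%:R * d%:R by rewrite natrM; ring.
by rewrite rpredD // rpredM // rpred_nat.
Qed.

Lemma p_integralM (x y : rat) : p_integral p x -> p_integral p y -> p_integral p (x * y).
Proof.
move=> /p_integralP[d cd xd] /p_integralP[e ce ye]; apply/p_integralP.
exists (d * e)%N; first by rewrite coprimeMl cd.
have -> : (x * y) * (d * e)%N%:R = x * d%:R * (y * e%:R) by rewrite natrM; ring.
by rewrite rpredM.
Qed.

Lemma p_integralN (x : rat) : p_integral p x -> p_integral p (- x).
Proof. by rewrite -mulN1r; apply: p_integralM; exact: (p_integral_int (-1)). Qed.

Lemma p_integralB (x y : rat) : p_integral p x -> p_integral p y -> p_integral p (x - y).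
Proof. by move=> xi yi; apply: p_integralD => //; apply: p_integralN. Qed.

Lemma p_integralX (x : rat) (n : nat) : p_integral p x -> p_integral p (x ^+ n).
Proof. 
by move=> xi; elim: n => [|n IH]; rewrite ?exprS; [exact: (p_integral_nat 1)|exact: p_integralM].
Qed.

Lemma p_integral_inv_nat (d : nat) : coprime d p -> p_integral p d%:R^-1.
Proof.
move=> cd; apply/p_integralP; exists d => //.
by case: d cd => [|d] cd; [rewrite mulr0 | rewrite mulVf ?pnatr_eq0 ?rpred1].
Qed.

Lemma coprime_between (a d : nat) :
  (a * p < d)%N -> (d < a.+1 * p)%N -> coprime d p.
Proof.
move=> lo hi; rewrite coprime_sym prime_coprime //; apply/negP => /dvdnP[q dq].
move: lo hi; rewrite dq !ltn_pmul2r ?prime_gt0 //; lia.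
Qed.

Lemma coprime_lt_prime (d : nat) : (0 < d)%N -> (d < p)%N -> coprime d p.
Proof. by move=> d0 dp; apply: (@coprime_between 0); rewrite ?mul0n ?mul1n. Qed.

Lemma congr_pkP (k : nat) (x y : rat) :
  congr_pk p k x y <-> exists2 z, p_integral p z & x = y + p%:R ^+ k * z.
Proof.
have pk0 : p%:R ^+ k != 0 :> rat by rewrite expf_neq0 // pnatr_eq0 -lt0n prime_gt0.
rewrite /congr_pk natrX; split=> [xy | [z zi ->]].
  by exists ((x - y) / p%:R ^+ k) => //; field.
suff -> : (y + p%:R ^+ k * z - y) / p%:R ^+ k = z by [].
by field.
Qed.

Lemma congr_pk_refl (k : nat) (x : rat) : congr_pk p k x x.
Proof. by apply/congr_pkP; exists 0; [exact: (p_integral_nat 0) | rewrite mulr0 addr0]. Qed.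

Lemma congr_pk_trans (k : nat) (y x z : rat) :
  congr_pk p k x y -> congr_pk p k y z -> congr_pk p k x z.
Proof.
case/congr_pkP => s si -> /congr_pkP[t ti ->]; apply/congr_pkP.
by exists (s + t); [exact: p_integralD | ring].
Qed.

Lemma congr_pkD (k : nat) (x y x' y' : rat) :
  congr_pk p k x y -> congr_pk p k x' y' -> congr_pk p k (x + x') (y + y').
Proof.
case/congr_pkP => s si -> /congr_pkP[t ti ->]; apply/congr_pkP.
by exists (s + t); [exact: p_integralD | ring].
Qed.

Lemma congr_pkMl (k : nat) (c x y : rat) :
  p_integral p c -> congr_pk p k x y -> congr_pk p k (c * x) (c * y).
Proof.
move=> ci /congr_pkP[s si ->]; apply/congr_pkP.
by exists (c * s); [exact: p_integralM | ring].
Qed.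

Lemma p_integral_congr (k : nat) (x y : rat) :
  p_integral p y -> congr_pk p k x y -> p_integral p x.
Proof.
move=> yi /congr_pkP[s si ->]; apply: p_integralD => //; apply: p_integralM => //.
by rewrite -natrX p_integral_nat.
Qed.

Lemma congr_pkM (k : nat) (x y x' y' : rat) : p_integral p y -> p_integral p y' ->
  congr_pk p k x y -> congr_pk p k x' y' -> congr_pk p k (x * x') (y * y').
Proof.
move=> yi y'i xy x'y'; apply: (@congr_pk_trans _ (x * y')).
  by apply: congr_pkMl x'y'; apply: p_integral_congr xy.
by rewrite ![_ * y']mulrC; apply: congr_pkMl.
Qed.

Lemma congr_pk_sum (k a b : nat) (f g : nat -> rat) :
  (forall i, (a <= i < b)%N -> congr_pk p k (f i) (g i)) ->
  congr_pk p k (\sum_(a <= i < b) f i) (\sum_(a <= i < b) g i).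
Proof.
move=> fg; rewrite big_nat_cond [X in congr_pk _ _ _ X]big_nat_cond.
elim/big_rec2: _ => [|i y x /andP[iab _] xy]; first exact: congr_pk_refl.
by apply: congr_pkD => //; exact: fg.
Qed.

Lemma congr_pk_shift (k : nat) (x y : rat) :
  congr_pk p k.+1 (p%:R * x) (p%:R * y) <-> congr_pk p k x y.
Proof.
have p0 : p%:R != 0 :> rat by rewrite pnatr_eq0 -lt0n prime_gt0.
split=> /congr_pkP[z zi e]; apply/congr_pkP; exists z => //.
  by apply: (mulfI p0); rewrite e exprS; ring.
by rewrite e exprS; ring.
Qed.

End PIntegral.

(** Only what division by [x] requires: [x] itself may have [p] in its denominator. *)
Definition p_unit (p : nat) (x : rat) : bool := (x != 0) && p_integral p x^-1.

Lemma p_unit_neq0 (p : nat) (x : rat) : p_unit p x -> x != 0.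
Proof. by case/andP. Qed.

Lemma p_integralV (p : nat) (x : rat) : p_unit p x -> p_integral p x^-1.
Proof. by case/andP. Qed.

Lemma p_unitN (p : nat) (x : rat) : p_unit p x -> p_unit p (- x).
Proof. by case/andP=> x0 xi; rewrite /p_unit oppr_eq0 x0 invrN p_integralN. Qed.

Lemma p_unitM (p : nat) (x y : rat) : p_unit p x -> p_unit p y -> p_unit p (x * y).
Proof.
by move=> /andP[x0 xi] /andP[y0 yi]; rewrite /p_unit mulf_neq0 // invfM p_integralM.
Qed.

Lemma p_integral1 (p : nat) : p_integral p 1.
Proof. exact: (p_integral_nat p 1). Qed.

Lemma p_unit1 (p : nat) : p_unit p 1.
Proof. by rewrite /p_unit oner_neq0 invr1 p_integral1. Qed.

Lemma p_unitX (p : nat) (x : rat) (n : nat) : p_unit p x -> p_unit p (x ^+ n).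
Proof. by move=> xu; elim: n => [|n IHn]; rewrite ?p_unit1 // exprS p_unitM. Qed.

Ltac p_unit := match goal with
  | H : is_true (p_unit _ ?x) |- is_true (p_unit _ ?x) => exact H
  | |- is_true (p_unit _ 1) => exact: p_unit1
  | |- is_true (p_unit _ (- _)) => apply: p_unitN; p_unit
  | |- is_true (p_unit _ (_ * _)) => apply: p_unitM; p_unit
  | |- is_true (p_unit _ (_ ^+ _)) => apply: p_unitX; p_unit
  end.

Ltac p_integral := match goal with
  | H : is_true (p_integral _ ?x) |- is_true (p_integral _ ?x) => exact H
  | |- is_true (p_integral _ 1) => exact: p_integral1
  | |- is_true (p_integral _ (_%:R)) => exact: p_integral_nat
  | |- is_true (p_integral _ (- _)) => apply: p_integralN; p_integral
  | |- is_true (p_integral _ (_ + _)) => apply: p_integralD; p_integral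
  | |- is_true (p_integral _ (_ * _)) => apply: p_integralM; p_integral
  | |- is_true (p_integral _ (_ ^+ _)) => apply: p_integralX; p_integral
  | |- is_true (p_integral _ (_^-1)) => apply: p_integralV; p_unit
  end.

(** * Even-index binomial sums *)

(** With [s^2 = y], [(1 + s)^n] is [even_binsum y n + s * odd_binsum y n]; the recurrences below are
    multiplication by [1 + s]. *)
Definition even_binsum (y : rat) (n : nat) : rat :=
  \sum_(0 <= j < n.+1) 'C(n, j.*2)%:R * y ^+ j.
Definition odd_binsum (y : rat) (n : nat) : rat :=
  \sum_(0 <= j < n.+1) 'C(n, j.*2.+1)%:R * y ^+ j.

Lemma even_binsumS (y : rat) (n : nat) :
  even_binsum y n.+1 = even_binsum y n + y * odd_binsum y n.
Proof.
rewrite /even_binsum /odd_binsum big_nat_recl // [in RHS]big_nat_recl //.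
rewrite double0 !bin0 -[RHS]addrA; congr (_ + _).
have -> : \sum_(0 <= i < n) 'C(n, i.+1.*2)%:R * y ^+ i.+1
        = \sum_(0 <= i < n.+1) 'C(n, i.+1.*2)%:R * y ^+ i.+1.
  by rewrite [RHS]big_nat_recr //= [X in _ + X * _](_ : _ = 0) ?mul0r ?addr0 // bin_small //; lia.
rewrite big_distrr -big_split /=; apply: eq_bigr => i _.
by rewrite doubleS binS natrD exprS; ring.
Qed.

Lemma odd_binsumS (y : rat) (n : nat) :
  odd_binsum y n.+1 = even_binsum y n + odd_binsum y n.
Proof.
rewrite /even_binsum /odd_binsum big_nat_recr //= [X in _ + X * _](_ : _ = 0); last first.
  by rewrite bin_small //; lia.
rewrite mul0r addr0 -big_split /=; apply: eq_bigr => i _.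
by rewrite binS natrD; ring.
Qed.

(** Even and odd indices each receive half of [2^(2n+1)]. The recurrences couple the two sums, so
    the induction carries both. *)
Lemma even_binsum1_odd (n : nat) : even_binsum 1 (2 * n + 1) = 4 ^+ n.
Proof.
suff /andP[/eqP //] : (even_binsum 1 (2 * n + 1) == 4 ^+ n) && (odd_binsum 1 (2 * n + 1) == 4 ^+ n).
elim: n => [|n /andP[/eqP eE /eqP oE]].
  by rewrite /even_binsum /odd_binsum unlock.
have -> : (2 * n.+1 + 1 = (2 * n + 1).+2)%N by lia.
by rewrite !(even_binsumS, odd_binsumS) eE oE exprS; apply/andP; split; apply/eqP; ring.
Qed.

(* The even part of [(1 + i) ^ (2n+1)] is its real part, which is [+- 2^n]. *)
Lemma even_binsumN1_odd (n : nat) : even_binsum (-1) (2 * n + 1) ^+ 2 = 4 ^+ n.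
Proof.
suff /andP[/eqP //] : (even_binsum (-1) (2 * n + 1) ^+ 2 == 4 ^+ n)
  && (odd_binsum (-1) (2 * n + 1) ^+ 2 == 4 ^+ n).
elim: n => [|n /andP[/eqP eE /eqP oE]].
  by rewrite /even_binsum /odd_binsum unlock.
have -> : (2 * n.+1 + 1 = (2 * n + 1).+2)%N by lia.
(* Two steps of the recurrence send [(E, O)] to [(-2 O, 2 E)], so each square comes from the other
   one. *)
rewrite !(even_binsumS, odd_binsumS) [4 ^+ n.+1]exprS -{1}oE -eE.
by apply/andP; split; apply/eqP; ring.
Qed.

(** * Harmonic and alternating harmonic sums *)

Definition harm (y : rat) (n : nat) : rat := \sum_(1 <= j < n.+1) y ^+ j / j%:R.

Lemma harmS (y : rat) (n : nat) : harm y n.+1 = harm y n + y ^+ n.+1 / n.+1%:R.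
Proof. by rewrite /harm big_nat_recr. Qed.

(** In [1/(k(k+1)) = 1/k - 1/(k+1)] the alternating sign makes the two parts add up instead of
    telescoping. *)
Lemma sum_alt_pronic (n : nat) :
  \sum_(1 <= k < n.+1) (-1) ^+ k / (k%:R * (k%:R + 1))
  = 2 * harm (-1) n.+1 + 1 - (-1) ^+ n.+1 / n.+1%:R :> rat.
Proof.
elim: n => [|n IHn]; first by rewrite big_geq // harmS /harm big_geq //.
rewrite big_nat_recr //= IHn (harmS _ n.+1) !exprS -!natr1.
have n0 := ler0n rat n.
by field; apply/andP; split; apply/eqP; lra.
Qed.

(** * Binomial coefficients and powers of 2 modulo p and p^2 *)

Section Prime.
Variable p : nat.
Hypothesis p_pr : prime p.

Lemma congr_p_addl (c : rat) : congr_pk p 1 (p%:R + c) c.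
Proof.
by apply/congr_pkP => //; exists 1; [exact: p_integral1 | rewrite expr1; ring].
Qed.

Lemma congr_pkV (k : nat) (x y : rat) : p_unit p x -> p_unit p y ->
  congr_pk p k x y -> congr_pk p k x^-1 y^-1.
Proof.
move=> xu yu; have x0 := p_unit_neq0 xu; have y0 := p_unit_neq0 yu.
move=> /(congr_pkP p_pr)[z zi xE]; apply/congr_pkP => //.
exists (- (z * x^-1 * y^-1)); first by p_integral.
by move: x0 {xu}; rewrite xE => x0; field; rewrite x0 y0.
Qed.

Lemma p_unit_between (a d : nat) (x : rat) :
  (a * p < d)%N -> (d < a.+1 * p)%N -> x = d%:R -> p_unit p x.
Proof.
move=> lo hi ->; have cdp := coprime_between p_pr lo hi.
by rewrite /p_unit pnatr_eq0 -lt0n (leq_ltn_trans _ lo) // p_integral_inv_nat.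
Qed.

Lemma congr_p_mulDl (c d : rat) : p_integral p d -> congr_pk p 1 (p%:R * d + c) c.
Proof. by move=> di; apply/congr_pkP => //; exists d => //; rewrite expr1; ring. Qed.

(** Drops [p] at the leaves only, so both sides must have the same shape. This is why factors are
    written [p + c] or [p * d + c] below, and why constants are left unevaluated. *)
Ltac p_congr := match goal with
  | |- congr_pk _ _ (p%:R + _) _ => exact: congr_p_addl
  | |- congr_pk _ _ (p%:R * _ + _) _ => apply: congr_p_mulDl; p_integral
  | |- congr_pk _ _ (_^-1) (_^-1) => apply: congr_pkV; [p_unit | p_unit | p_congr]
  | |- congr_pk _ _ (_ * _) (_ * _) =>
      apply: (congr_pkM p_pr); [p_integral | p_integral | p_congr | p_congr]
  | |- _ => exact: (congr_pk_refl p_pr)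
  end.

Ltac p_unit_range a d := apply: (@p_unit_between a d);
  [lia | lia | first [by ring | by rewrite natrB; [ring | lia]]].

(** By Pascal's rule two neighbours in row [p - 1] add up to ['C(p, i.+1)], a multiple of [p]. *)
Lemma congr_bin_pred_prime (i : nat) : (i < p)%N ->
  congr_pk p 1 'C(p.-1, i)%:R ((-1) ^+ i).
Proof.
elim: i => [_|i IHi ip]; first by rewrite bin0; exact: congr_pk_refl.
have /dvdnP[c cE] : (p %| 'C(p, i.+1))%N by rewrite prime_dvd_bin.
have /(congr_pkP p_pr)[z zi zE] := IHi (ltnW ip).
apply/congr_pkP => //; exists (c%:R - z).
  by rewrite p_integralB // p_integral_nat.
have : 'C(p, i.+1)%:R = 'C(p.-1, i.+1)%:R + 'C(p.-1, i)%:R :> rat.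
  by rewrite -natrD -binS prednK ?prime_gt0.
rewrite cE natrM zE => e.
by rewrite [(-1) ^+ i.+1]exprS -[LHS](addrK ((-1) ^+ i + p%:R ^+ 1 * z)) -e; ring.
Qed.

(** Absorption gives ['C(p, i) = p / i * 'C(p - 1, i - 1)], and the factor [p] raises a congruence
    modulo [p] to one modulo [p^2]. *)
Lemma congr_bin_prime (i : nat) : (0 < i < p)%N ->
  congr_pk p 2 'C(p, i)%:R (- (p%:R * ((-1) ^+ i / i%:R))).
Proof.
case: i => // i /= ip.
have i0 : i.+1%:R != 0 :> rat by rewrite pnatr_eq0.
have -> : 'C(p, i.+1)%:R = p%:R * ('C(p.-1, i)%:R / i.+1%:R) :> rat.
  apply: (mulfI i0); rewrite -natrM -mul_bin_diag natrM [RHS]mulrCA; congr (_ * _).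
  by rewrite mulrCA divff ?mulr1.
rewrite -mulrN exprS mulN1r mulNr opprK; apply/congr_pk_shift => //.
rewrite ![_ / _]mulrC; apply: congr_pkMl => //.
  by apply: p_integral_inv_nat; apply: coprime_lt_prime.
by apply: congr_bin_pred_prime; apply: ltnW.
Qed.

Variable N : nat.
Hypothesis pE : p = (2 * N + 1)%N.

Lemma p_integral_harm (y : rat) (n : nat) : p_integral p y -> (n < p)%N -> p_integral p (harm y n).
Proof.
move=> yi; elim: n => [|n IHn] np; first by rewrite /harm big_geq // (p_integral_nat _ 0).
rewrite harmS p_integralD ?IHn ?(ltnW np) // p_integralM ?p_integralX //.
by apply: p_integral_inv_nat; apply: coprime_lt_prime.
Qed.

Let P2 : (2%:R : rat) * N%:R + 1 = p%:R.
Proof. by rewrite pE natrD natrM. Qed.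

Lemma p_integral_half : p_integral p 2^-1.
Proof.
apply: p_integral_inv_nat; apply: coprime_lt_prime => //.
by move: (prime_gt1 p_pr); rewrite pE; lia.
Qed.

(** At even indices the sign disappears: ['C(p, 2j)] is [- p / (2j)] for [0 < j <= N], and it
    vanishes for [j > N]. *)
Lemma congr_even_binsum (y : rat) : p_integral p y ->
  congr_pk p 2 (even_binsum y p) (1 - p%:R / 2 * harm y N).
Proof.
move=> yi; rewrite /even_binsum.
have -> : \sum_(0 <= j < p.+1) 'C(p, j.*2)%:R * y ^+ j
        = \sum_(0 <= j < N.+1) 'C(p, j.*2)%:R * y ^+ j.
  rewrite (@big_cat_nat _ _ _ N.+1) //=; last by rewrite pE; lia.
  rewrite [X in _ + X]big_nat_cond [X in _ + X]big1 ?addr0 // => i /andP[/andP[Ni _] _].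
  by rewrite bin_small ?mul0r // pE; lia.
rewrite big_nat_recl // double0 bin0 expr0 mulr1; apply: congr_pkD => //.
  exact: congr_pk_refl.
rewrite /harm big_add1 /= mulr_sumr -sumrN; apply: congr_pk_sum => // i /andP[_ iN].
have -> : - (p%:R / 2 * (y ^+ i.+1 / i.+1%:R))
        = - (p%:R * ((-1) ^+ i.+1.*2 / i.+1.*2%:R)) * y ^+ i.+1 :> rat.
  rewrite -mul2n natrM exprM sqrrN !expr1n.
  have i0 := ler0n rat i; by field; apply/eqP; lra.
rewrite ![_ * y ^+ _]mulrC; apply: congr_pkMl; rewrite ?p_integralX //.
by apply: congr_bin_prime; rewrite pE; lia.
Qed.

Lemma congr_pow2_harm : congr_pk p 2 (4 ^+ N) (1 - p%:R / 2 * harm 1 N).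
Proof.
by rewrite -even_binsum1_odd -pE; apply: congr_even_binsum; exact: p_integral1.
Qed.

(** At [y = -1] the even sum is a square root of [4 ^+ N]; squaring its expansion turns [p / 2] into
    [p]. *)
Lemma congr_pow2_harm_alt : congr_pk p 2 (4 ^+ N) (1 - p%:R * harm (-1) N).
Proof.
have N1i : p_integral p (-1) by exact: (p_integral_int _ (-1)).
have Hi : p_integral p (harm (-1) N) by apply: p_integral_harm; rewrite // pE; lia.
rewrite -even_binsumN1_odd -pE.
have /(congr_pkP p_pr)[z zi ->] := congr_even_binsum N1i.
apply/congr_pkP => //.
exists ((harm (-1) N / 2) ^+ 2 + 2 * (1 - p%:R * (harm (-1) N / 2)) * z + p%:R ^+ 2 * z ^+ 2).
  have half := p_integral_half; by p_integral.
by field.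
Qed.

(** With [u = p / (n + 1)], passing from [n] to [n + 1] multiplies by
    [(u - 1)^2 (u + 1) = 1 - u - u^2 + u^3], which is [1 - u] modulo [p^2]. *)
Lemma congr_bin_square_bin (n : nat) : (n < p)%N ->
  congr_pk p 2 ('C(p.-1, n)%:R ^+ 2 * 'C(p + n, n)%:R) (1 - p%:R * harm 1 n).
Proof.
elim: n => [|n IHn] np.
  by rewrite !bin0 expr1n mulr1 /harm big_geq // mulr0 subr0; exact: congr_pk_refl.
have nge0 := ler0n rat n; have n0 : n%:R + 1 != 0 :> rat by rewrite natr1 pnatr_eq0.
have e1 : 'C(p.-1, n.+1)%:R = 'C(p.-1, n)%:R * (p%:R / (n%:R + 1) - 1) :> rat.
  apply: (mulfI n0); rewrite natr1 -natrM mul_bin_left natrM natrB; last by lia.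
  rewrite -subn1 natrB ?prime_gt0 //; field; apply/eqP; lra.
have e2 : 'C(p + n.+1, n.+1)%:R = 'C(p + n, n)%:R * (p%:R / (n%:R + 1) + 1) :> rat.
  apply: (mulfI n0); rewrite natr1 -natrM addnS -mul_bin_diag /= natrM -addnS natrD.
  by field; apply/eqP; lra.
have /(congr_pkP p_pr)[z zi zE] := IHn (ltnW np).
have Ii : p_integral p (n%:R + 1)^-1.
  by rewrite natr1; apply: p_integral_inv_nat; apply: coprime_lt_prime.
have Hi : p_integral p (harm 1 n).
  by apply: p_integral_harm (ltnW np); exact: p_integral1.
rewrite e1 e2 harmS expr1n -natr1.
have -> : ('C(p.-1, n)%:R * (p%:R / (n%:R + 1) - 1)) ^+ 2
    * ('C(p + n, n)%:R * (p%:R / (n%:R + 1) + 1))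
  = ('C(p.-1, n)%:R ^+ 2 * 'C(p + n, n)%:R)
    * (1 - p%:R * (n%:R + 1)^-1 - p%:R ^+ 2 * (n%:R + 1)^-1 ^+ 2
       + p%:R ^+ 3 * (n%:R + 1)^-1 ^+ 3) :> rat.
  by field.
rewrite zE; move: (_^-1) Ii (harm 1 n) Hi => i Ii H Hi.
apply/congr_pkP => //.
exists (H * i + z * (1 - p%:R * i) + (1 - p%:R * H + p%:R ^+ 2 * z) * (p%:R * i ^+ 3 - i ^+ 2)).
  by p_integral.
by ring.
Qed.

(** * The dual sum modulo p^3 *)

Lemma dual_term0_prime : dual_term N 0 = p%:R *
  (4 * (3 * p%:R + 1) / (p%:R + 1) ^+ 2 * ('C(p.-1, N)%:R ^+ 2 * 'C(p + N, N)%:R)).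
Proof.
have -> : (p.-1 = 2 * N)%N by rewrite pE; lia.
have -> : (p + N = 3 * N + 1)%N by rewrite pE; lia.
by rewrite dual_term0 -pE !mulrA [p%:R * 4]mulrC.
Qed.

Lemma dual_termS_prime (k : nat) (K := k%:R : rat) : (k < N)%N ->
  dual_term N k.+1 = dual_term N k *
    ((2 * K + 3) * (p%:R + (2 + 2 * K)) * (p%:R + (- 1 - 2 * K)) * (p%:R + - K)
     / ((2 * K + 1) * (p%:R + (3 + 2 * K)) * (p%:R + (- 2 - 2 * K)) * (p%:R + (2 + K)))).
Proof.
move=> kN; have [j jE] : exists j, N = (k + j.+1)%N by exists (N - k.+1)%N; lia.
have := dual_termS j k; rewrite /= -jE -pE => ->; rewrite -/K.
by congr (_ * (_ / _)); ring.
Qed.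

Lemma p_ge5 : (1 < N)%N -> (5 <= p)%N. Proof. by rewrite pE; lia. Qed.

Lemma congr_bin_square_bin1 (n : nat) : (n < p)%N ->
  congr_pk p 1 ('C(p.-1, n)%:R ^+ 2 * 'C(p + n, n)%:R) 1.
Proof.
move=> np; have /(congr_pkP p_pr)[z zi ->] := congr_bin_square_bin np.
have Hi := p_integral_harm (p_integral1 p) np.
apply/congr_pkP => //; exists (p%:R * z - harm 1 n); first by p_integral.
by ring.
Qed.

Let P0 : p%:R != 0 :> rat.
Proof. by rewrite pnatr_eq0 -lt0n prime_gt0. Qed.

(** One factor [p] comes from the term [k = 0], the other from the ratio, whose factor [p - k] is
    [p] at [k = 0]. *)
Lemma dual_term1_congr : (1 < N)%N -> congr_pk p 1 (dual_term N 1 / p%:R ^+ 2) 2.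
Proof.
move=> N1; have p5 := p_ge5 N1.
have U1 : p_unit p (p%:R + 1) by p_unit_range 1%N (p + 1)%N.
have U2 : p_unit p (p%:R + -2) by p_unit_range 0%N (p - 2)%N.
have U3 : p_unit p (p%:R + 3) by p_unit_range 1%N (p + 3)%N.
have V2 : p_unit p 2 by p_unit_range 0%N 2%N.
have V3 : p_unit p 3 by p_unit_range 0%N 3%N.
have cc : congr_pk p 1 ('C(p.-1, N)%:R ^+ 2 * 'C(p + N, N)%:R) 1.
  by apply: congr_bin_square_bin1; lia.
rewrite dual_termS_prime ?dual_term0_prime; last by lia.
move: (_ * _%:R) cc => c cc.
have P2n : p%:R + 2 != 0 :> rat by rewrite -natrD pnatr_eq0; lia.
have -> : p%:R * (4 * (3 * p%:R + 1) / (p%:R + 1) ^+ 2 * c)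
   * ((2 * 0 + 3) * (p%:R + (2 + 2 * 0)) * (p%:R + (-1 - 2 * 0)) * (p%:R + - 0) /
    ((2 * 0 + 1) * (p%:R + (3 + 2 * 0)) * (p%:R + (-2 - 2 * 0)) * (p%:R + (2 + 0)))) / p%:R ^+ 2
   = 12 * (p%:R * 3 + 1) * (p%:R + -1) / ((p%:R + 1) * (p%:R + 1) * (p%:R + 3) * (p%:R + -2)) * c
   :> rat.
  have n1 := p_unit_neq0 U1; have n2 := p_unit_neq0 U2; have n3 := p_unit_neq0 U3.
  by field; rewrite P0 P2n n1 n2 n3.
have e2 : 2 = 12 * 1 * -1 / (1 * 1 * 3 * -2) * 1 :> rat by field.
rewrite [X in congr_pk _ _ _ X]e2.
apply: (congr_pkM p_pr); [by p_integral | by p_integral | by p_congr | exact: cc].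
Qed.

(** Without [p] the factors cancel in pairs up to sign, except [- K] over [2 + K]. The bound on [k]
    keeps [3 + 2k] below [p]. *)
Lemma dual_ratio_congr (k : nat) (K := k%:R : rat) : (k.+1 < N)%N ->
  congr_pk p 1
    ((2 * K + 3) * (p%:R + (2 + 2 * K)) * (p%:R + (- 1 - 2 * K)) * (p%:R + - K)
     / ((2 * K + 1) * (p%:R + (3 + 2 * K)) * (p%:R + (- 2 - 2 * K)) * (p%:R + (2 + K))))
    (- (K / (K + 2))).
Proof.
move=> kN; rewrite /K {K}.
have U1 : p_unit p (2 * k%:R + 1) by p_unit_range 0%N (2 * k + 1)%N.
have U2 : p_unit p (p%:R + (3 + 2 * k%:R)) by p_unit_range 1%N (p + (3 + 2 * k))%N.
have U3 : p_unit p (p%:R + (-2 - 2 * k%:R)) by p_unit_range 0%N (p - (2 + 2 * k))%N.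
have U4 : p_unit p (p%:R + (2 + k%:R)) by p_unit_range 1%N (p + (2 + k))%N.
have V2 : p_unit p (3 + 2 * k%:R) by p_unit_range 0%N (3 + 2 * k)%N.
have V3 : p_unit p (-2 - 2 * k%:R).
  rewrite -opprD; apply: p_unitN; p_unit_range 0%N (2 + 2 * k)%N.
have V4 : p_unit p (2 + k%:R) by p_unit_range 0%N (2 + k)%N.
have -> : - (k%:R / (k%:R + 2))
  = (2 * k%:R + 3) * (2 + 2 * k%:R) * (-1 - 2 * k%:R) * - k%:R /
    ((2 * k%:R + 1) * (3 + 2 * k%:R) * (-2 - 2 * k%:R) * (2 + k%:R)) :> rat.
  have k0 := ler0n rat k.
  by field; repeat (apply/andP; split); apply/eqP; lra.
by p_congr.
Qed.

(** The ratios [- K / (K + 2)] telescope from the value [2] at [k = 1]. *)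
Lemma dual_term_congr (k : nat) (K := k%:R : rat) : (0 < k < N)%N ->
  congr_pk p 1 (dual_term N k / p%:R ^+ 2) (- 4 * ((-1) ^+ k / (K * (K + 1)))).
Proof.
rewrite /K; elim: k {K} => // k IHk kN.
have [kz|kpos] := posnP k.
  have -> : -4 * ((-1) ^+ k.+1 / (k.+1%:R * (k.+1%:R + 1))) = 2 :> rat.
    by rewrite kz expr1; field.
  by rewrite kz; apply: dual_term1_congr; lia.
have U1 : p_unit p k%:R by p_unit_range 0%N k.
have U2 : p_unit p (k%:R + 1) by p_unit_range 0%N (k + 1)%N.
have U3 : p_unit p (k%:R + 2) by p_unit_range 0%N (k + 2)%N.
rewrite dual_termS_prime; last by lia.
rewrite mulrAC.
have -> : -4 * ((-1) ^+ k.+1 / (k.+1%:R * (k.+1%:R + 1)))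
  = -4 * ((-1) ^+ k / (k%:R * (k%:R + 1))) * - (k%:R / (k%:R + 2)) :> rat.
  by rewrite exprS; field; rewrite (p_unit_neq0 U1) (p_unit_neq0 U2) (p_unit_neq0 U3).
apply: (congr_pkM p_pr); [by p_integral | by p_integral | |].
  by apply: IHk; lia.
by apply: dual_ratio_congr; lia.
Qed.

(* Half of the general formula, because the factor [(2k+1) / (p+2k+1)] of the term,
   which is [1] modulo [p] for [k < N], equals [1/2] at [k = N]. *)
Lemma dual_term_last_congr : (1 < N)%N ->
  congr_pk p 1 (dual_term N N / p%:R ^+ 2) (8 * (-1) ^+ N).
Proof.
move=> N1; have p5 := p_ge5 N1.
have [n nE] : exists n, N = n.+2 by exists N.-2; lia.
have nP : n%:R = (p%:R - 5) / 2 :> rat.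
  by rewrite pE nE; field.
have IH : congr_pk p 1 (dual_term N n.+1 / p%:R ^+ 2)
    (-4 * ((-1) ^+ n.+1 / (n.+1%:R * (n.+1%:R + 1)))).
  by apply: dual_term_congr; lia.
have P5 : 5 <= p%:R :> rat by rewrite ler_nat.
have U1 : p_unit p (p%:R + -3) by p_unit_range 0%N (p - 3)%N.
have U2 : p_unit p (p%:R + -1) by p_unit_range 0%N (p - 1)%N.
have U3 : p_unit p (p%:R + -2) by p_unit_range 0%N (p - 2)%N.
have U4 : p_unit p (p%:R * 3 + 1) by p_unit_range 3%N (p * 3 + 1)%N.
have V2 : p_unit p 2 by p_unit_range 0%N 2%N.
have V3 : p_unit p 3 by p_unit_range 0%N 3%N.
have -> : dual_term N N = dual_term N n.+2 by rewrite -nE.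
rewrite dual_termS_prime; last by lia.
rewrite mulrAC.
(* Here [k = N - 1 = (p - 3) / 2], so [2k + 3 = p] and [p + 3 + 2k = 2p] must be cancelled before
   reducing modulo [p]. *)
have -> : (2 * n.+1%:R + 3) * (p%:R + (2 + 2 * n.+1%:R)) * (p%:R + (-1 - 2 * n.+1%:R))
    * (p%:R + - n.+1%:R)
    / ((2 * n.+1%:R + 1) * (p%:R + (3 + 2 * n.+1%:R)) * (p%:R + (-2 - 2 * n.+1%:R))
       * (p%:R + (2 + n.+1%:R)))
  = (p%:R * 2 + -1) * (p%:R + 3) / ((p%:R + -2) * (p%:R * 3 + 1)) :> rat.
  rewrite -(natr1 n) nP; field.
  by repeat (apply/andP; split); apply/eqP; lra.
have E4 : -4 * ((-1) ^+ n.+1 / (n.+1%:R * (n.+1%:R + 1)))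
  = (-1) ^+ N * (16 / ((p%:R + -3) * (p%:R + -1))) :> rat.
  rewrite nE !exprS -(natr1 n) nP; field.
  by repeat (apply/andP; split); apply/eqP; lra.
have -> : 8 * (-1) ^+ N = (-1) ^+ N * (16 / (-3 * -1)) * (-1 * 3 / (-2 * 1)) :> rat by field.
apply: (congr_pkM p_pr); [by p_integral | by p_integral | | by p_congr].
by apply: (congr_pk_trans p_pr IH); rewrite E4; p_congr.
Qed.

Lemma dual_term_tail_congr : (1 < N)%N ->
  congr_pk p 1 (\sum_(1 <= k < N.+1) dual_term N k / p%:R ^+ 2)
    (-4 * (2 * harm (-1) N + 1)).
Proof.
move=> N1; rewrite big_nat_recr /=; last by lia.
have [n nE] : exists n, N = n.+1 by exists N.-1; lia.
have Nu : p_unit p N%:R by p_unit_range 0%N N.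
apply: (@congr_pk_trans _ p_pr _ (-4 * (2 * harm (-1) N + 1 - (-1) ^+ N / N%:R) + 8 * (-1) ^+ N)).
  apply: (congr_pkD p_pr); last exact: dual_term_last_congr.
  have -> : 2 * harm (-1) N + 1 - (-1) ^+ N / N%:R
    = \sum_(1 <= k < N) (-1) ^+ k / (k%:R * (k%:R + 1)) :> rat.
    by rewrite nE sum_alt_pronic.
  rewrite mulr_sumr.
  by apply: (congr_pk_sum p_pr) => k kN; apply: dual_term_congr.
(* The boundary term and the last term cancel modulo [p], since
   [4 / N + 8 = 4 (2N + 1) / N = 4 p / N]. *)
apply/(congr_pkP p_pr); exists (4 * ((-1) ^+ N / N%:R)); first by p_integral.
by have N0 := p_unit_neq0 Nu; rewrite -P2; field.
Qed.

Lemma dual_term_sum_congr : (1 < N)%N ->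
  congr_pk p 3 (\sum_(0 <= k < N.+1) dual_term N k)
    (p%:R * (4 * (4 * 4 ^+ N - 3))).
Proof.
move=> N1; have p5 := p_ge5 N1.
rewrite big_ltn // dual_term0_prime.
have -> : \sum_(1 <= k < N.+1) dual_term N k
  = p%:R * (p%:R * \sum_(1 <= k < N.+1) dual_term N k / p%:R ^+ 2).
  by rewrite !mulr_sumr; apply: eq_bigr => k _; field.
rewrite -mulrDr; apply/(congr_pk_shift p_pr).
have Uu : p_unit p (p%:R + 1) by p_unit_range 1%N (p + 1)%N.
have U0 := p_unit_neq0 Uu.
have Np : (N < p)%N by lia.
have Hi := p_integral_harm (p_integral1 p) Np.
have Ai := p_integral_harm (p_integralN (p_integral1 p)) Np.
have /(congr_pkP p_pr)[z1 i1 e1] := dual_term_tail_congr N1.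
have /(congr_pkP p_pr)[z2 i2 e2] := congr_bin_square_bin Np.
have /(congr_pkP p_pr)[z3 i3 e3] := congr_pow2_harm.
have /(congr_pkP p_pr)[z4 i4 e4] := congr_pow2_harm_alt.
rewrite e1 e2; apply/(congr_pkP p_pr).
move: (4 ^+ N) e3 e4 => x e3 e4.
have xH : p%:R * harm 1 N = 2 * (1 - x) + 2 * p%:R ^+ 2 * z3 :> rat by rewrite e3; field.
have xA : p%:R * harm (-1) N = 1 - x + p%:R ^+ 2 * z4 :> rat by rewrite e4; ring.
(* Uses [(3p + 1) / (p + 1)^2 = 1 + p - p^2 (p + 3) / (p + 1)^2]. Eliminating [p H] and [p A] by
   [xH] and [xA] leaves [8 p (x - 1)], a multiple of [p^2] because [x] is [1] modulo [p]. *)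
exists (- (4 * (p%:R + 3) / (p%:R + 1) ^+ 2) * (1 - p%:R * harm 1 N + p%:R ^+ 2 * z2)
  + 4 * (1 + p%:R) * (z2 - 2 * z3) - 8 * z4 + z1 - 8 * (harm (-1) N - p%:R * z4)).
  by p_integral.
(* Obtained by equating the two expansions of [x] and dividing by [p]. *)
have HE : harm 1 N = 2 * harm (-1) N - 2 * p%:R * z4 + 2 * p%:R * z3.
  by apply: (mulfI P0); rewrite xH e4; ring.
by rewrite HE e4; field.
Qed.

Lemma summand_sum_congr : (1 < N)%N ->
  congr_pk p 3 (\sum_(0 <= k < N.+1) summand k) (3 * p%:R * 4 ^+ N).
Proof.
move=> N1; have p5 := p_ge5 N1.
rewrite sum_summand_dual /dual_summand -mulr_sumr.
have Np : (N < p)%N by lia.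
have Ai := p_integral_harm (p_integralN (p_integral1 p)) Np.
have V4 : p_unit p 4 by p_unit_range 0%N 4%N.
have xu : p_unit p (4 ^+ N) by p_unit.
have x0 := p_unit_neq0 xu.
have -> : 48 / (64 ^ N.+1)%N%:R = 3 / 4 * (4 ^+ N)^-1 ^+ 3 :> rat.
  have -> : (64 ^ N.+1)%N%:R = 64 * (4 ^+ N) ^+ 3 :> rat.
    by rewrite exp64S natrX -exprM mulnC exprM -natrX.
  by field.
apply: (@congr_pk_trans _ p_pr _ (3 / 4 * (4 ^+ N)^-1 ^+ 3 * (p%:R * (4 * (4 * 4 ^+ N - 3))))).
  apply: (congr_pkMl p_pr); first by p_integral.
  exact: dual_term_sum_congr.
have /(congr_pkP p_pr)[z zi e] := congr_pow2_harm_alt.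
have xi : p_integral p (4 ^+ N) by p_integral.
move: (4 ^+ N) e xu x0 xi => x e xu x0 xi.
have xE : x - 1 = p%:R * (p%:R * z - harm (-1) N) by rewrite e; ring.
apply/(congr_pkP p_pr).
(* The difference is [- 3 p (x^4 - 4x + 3) / x^3], and [x^4 - 4x + 3 = (x - 1)^2 (x^2 + 2x + 3)]
   with [x - 1] divisible by [p]. *)
exists (- 3 * (p%:R * z - harm (-1) N) ^+ 2 * (x ^+ 2 + 2 * x + 3) * x^-1 ^+ 3); first by p_integral.
have -> : p%:R ^+ 3 * (- 3 * (p%:R * z - harm (-1) N) ^+ 2 * (x ^+ 2 + 2 * x + 3) * x^-1 ^+ 3)
  = p%:R * (- 3 * (p%:R * (p%:R * z - harm (-1) N)) ^+ 2 * (x ^+ 2 + 2 * x + 3) * x^-1 ^+ 3) by ring.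
by rewrite -xE; field.
Qed.
End Prime.

Unset Implicit Arguments.

Theorem theorem1p4 (p : nat) : prime p -> (2 < p)%N ->
  congr_pk p 3
    (\sum_(0 <= k < (p.-1)./2.+1)
        ((11 * k + 3)%N%:R / (64 ^ k)%N%:R
         * ('C(k.*2, k) ^ 2 * 'C(3 * k, k))%N%:R))
    (3 * p%:R + 3 * p%:R ^+ 2 * fermat_q2 p).
Proof.
move=> p_pr p_gt2.
have [N pE] : exists N, p = (2 * N + 1)%N.
  exists (p.-1)./2; have := odd_double_half p; case: (even_prime p_pr) => [|->] /=; lia.
have -> : (p.-1)./2 = N by rewrite pE addn1 /= mul2n doubleK.
have P0 : p%:R != 0 :> rat by rewrite pnatr_eq0 -lt0n prime_gt0.
(* As [p * fermat_q2 p = 2^(p-1) - 1], the right side is [3 p 2^(p-1)]. *)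
have -> : 3 * p%:R + 3 * p%:R ^+ 2 * fermat_q2 p = 3 * p%:R * 4 ^+ N :> rat.
  have -> : 4 ^+ N = (2 ^ p.-1)%N%:R :> rat by rewrite pE addn1 /= expnM natrX.
  by rewrite /fermat_q2; field.
(* The general argument divides by [3]; the prime [p = 3] is settled by computation. *)
have [N1|N1] := ltnP 1 N; first exact: (summand_sum_congr p_pr pE N1).
have -> : N = 1%N by lia.
have -> : p = 3%N by lia.
by rewrite !big_nat_recr //= big_geq // !binS !bin0 !bin0n.
Qed.
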